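(* For all integers $k\ge h\ge 1$, $$\nabla_2(e_ke_h)=2(n-k)\,e_{k-1}e_{h-1}-2\sum_{i=1}^{h-1}(k-h+2i)\,e_{k+i-1}e_{h-i-1}.$$
   Context: Let $n\ge 2$ and let $e_k=e_k(x_2,x_3,\dots,x_n)$ be the elementary symmetric polynomial of degree $k$ in the $n-1$ variables $x_2,\dots,x_n$ ($e_0=1$, and $e_k=0$ for $k<0$ or $k>n-1$). $\nabla_2=\sum_{i=1}^n\partial_i^2$ with $\partial_i=\partial/\partial x_i$. *)

(* Defs.v *)
From mathcomp Require Import all_boot all_order all_algebra.
From mathcomp.multinomials Require Import mpoly.
Set Implicit Arguments.
Unset Strict Implicit.
Unset Printing Implicit Defensive.
Import GRing.Theory.
Local Open Scope ring_scope.

(* The variables x_1, ..., x_n are 'X_i for i : 'I_n, numbered from 0: x_1 is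
   the variable of index 0, and [shift_ord] enumerates the indices of
   x_2, ..., x_n. *)
Definition shift_ord (n : nat) (j : 'I_n.-1) : 'I_n :=
  Ordinal (etrans (esym (ltn_predRL j n)) (ltn_ord j)).

(* e_k(x_2, ..., x_n) in R[x_1, ..., x_n]. *)
Definition etail (n : nat) (R : comNzRingType) (k : nat) : {mpoly R[n]} :=
  mesym n.-1 R k \mPo [tuple ('X_(shift_ord j) : {mpoly R[n]}) | j < n.-1].

Definition laplacian (n : nat) (R : comNzRingType) (p : {mpoly R[n]}) :
    {mpoly R[n]} :=
  \sum_(i < n) p^`M(i)^`M(i).

(* Main.v *)
Require Import Defs.
From mathcomp Require Import all_boot all_order all_algebra.
From mathcomp.multinomials Require Import mpoly.
From mathcomp Require Import ring.
Set Implicit Arguments.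
Unset Strict Implicit.
Unset Printing Implicit Defensive.
Import GRing.Theory.
Local Open Scope ring_scope.

(** Each [e_k] has degree at most one in every variable, so the pure second
    derivatives of [e_k] and [e_h] vanish and the Laplacian of [e_k e_h] reduces
    to the cross terms [2 \sum_j (d_j e_k) (d_j e_h)].  Moreover [d_j e_k] is
    [e_(k-1)] of the variables other than [x_j].  Writing [e_p^(j)] for [e_p]
    without the variable [x_j], what remains is to expand
    [S p q = \sum_j e_p^(j) e_q^(j)] in products of full elementary symmetric
    polynomials ([sum_esymD1M]).

    The expansion comes from evaluating [x_j e_p^(j) e_q^(j)] in two ways with
    the Pascal rule [e_(p+1) = e_(p+1)^(j) + x_j e_p^(j)] ([esym_pascal]), the
    factor [x_j] being absorbed either into [e_p^(j)] or into [e_q^(j)].  Summing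
    over [j], where [\sum_j e_p^(j) = (m - p) e_p] for [m] variables
    ([sum_esymD1]), expresses [S p (q + 1)] through [S (p + 1) q]
    ([sum_esymD1M_rec]), and the second index descends to [0]. *)

(** * Elementary symmetric functions of a finite family *)

(** The set [D] of allowed indices makes deleting a variable an operation on
    sets, so that no change of the number of variables is ever required. *)
Definition esym (S : comNzRingType) (I : finType) (x : I -> S) (D : {set I})
    (k : nat) : S :=
  \sum_(A : {set I} | (A \subset D) && (#|A| == k)) \prod_(i in A) x i.

Section Esym.

Variables (S : comNzRingType) (I : finType) (x : I -> S).
Implicit Types (D : {set I}) (p q k : nat).

Lemma esym0 D : esym x D 0 = 1.
Proof.
rewrite /esym (big_pred1 set0) ?big_set0 // => A /=.
by rewrite cards_eq0; case: eqP => [->|_]; rewrite ?sub0set ?andbF.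
Qed.

(** The subsets of [D] with [k + 1] elements are sorted according to whether
    they contain [j]. *)
Lemma esym_pascal D j k : j \in D ->
  esym x D k.+1 = esym x (D :\ j) k.+1 + x j * esym x (D :\ j) k.
Proof.
move=> jD; rewrite /esym (bigID (fun A : {set I} => j \in A)) /= addrC.
congr (_ + _).
  by apply: eq_bigl => A; rewrite subsetD1 -!andbA; congr (_ && _); rewrite andbC.
rewrite mulr_sumr (reindex_onto (fun B => j |: B) (fun A => A :\ j)) /=; last first.
  by move=> A /andP[_ jA]; rewrite setD1K.
have jP B : [&& (j |: B \subset D) && (#|j |: B| == k.+1), j \in j |: B
              & (j |: B) :\ j == B] = (B \subset D :\ j) && (#|B| == k).
  rewrite setU11 /= subsetD1 subUset sub1set jD /=.
  case: (boolP (j \in B)) => jB; rewrite ?andbF ?andbT /=.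
    have -> // : ((j |: B) :\ j == B) = false.
    apply/eqP => /setP /(_ j); rewrite jB !inE eqxx //.
    by rewrite andbF.
  by rewrite setU1K // eqxx andbT cardsU1 jB eqSS.
apply: eq_big => [B|B]; first by rewrite -jP -andbA.
rewrite -andbA jP subsetD1 => /andP[/andP[_ jB] _].
by rewrite big_setU1.
Qed.

(** A subset [A] of [D] with [p] elements avoids exactly [#|D| - p] of the
    indices [j]. *)
Lemma sum_esymD1 D p :
  \sum_(j in D) esym x (D :\ j) p = (#|D|%:R - p%:R) * esym x D p.
Proof.
rewrite /esym mulr_sumr.
rewrite (exchange_big_dep (fun A : {set I} => (A \subset D) && (#|A| == p))) /=;
  last by move=> j A _ /andP[]; rewrite subsetD1 => /andP[-> _] ->.
apply: eq_bigr => A /andP[AD /eqP cA].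
have -> : #|D|%:R - p%:R = #|D :\: A|%:R :> S.
  by rewrite cardsD (setIidPr AD) cA natrB // -cA subset_leq_card.
rewrite mulr_natl -sumr_const; apply: eq_bigl => j.
by rewrite subsetD1 AD cA eqxx !inE andbT andbC.
Qed.

(** The relation obtained by summing over [j] the two evaluations of
    [x_j e_p^(j) e_q^(j)]. *)
Lemma sum_esymD1M_rec D p q :
  \sum_(j in D) esym x (D :\ j) p * esym x (D :\ j) q.+1 =
    (#|D|%:R - p%:R) * esym x D p * esym x D q.+1
    - (#|D|%:R - q%:R) * esym x D p.+1 * esym x D q
    + \sum_(j in D) esym x (D :\ j) p.+1 * esym x (D :\ j) q.
Proof.
rewrite -sum_esymD1 [X in _ - X + _]mulrAC -sum_esymD1 !mulr_suml.
rewrite -sumrB -big_split /=.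
by apply: eq_bigr => j jD; rewrite !(esym_pascal _ jD); ring.
Qed.

(** Descending from [q + 1] to [q], the two multiples of [e_(p+1) e_q] combine
    to [(#|D| - (p + 1)) - (#|D| - q) = - (p + 1 - q)], which is the new term of
    index [i = 1]; the earlier terms are shifted by one and keep their
    coefficients, since [p - q + 2 i] absorbs the change of [p] and [q]. *)
Lemma sum_esymD1M D p q :
  \sum_(j in D) esym x (D :\ j) p * esym x (D :\ j) q =
    (#|D|%:R - p%:R) * esym x D p * esym x D q
    - \sum_(1 <= i < q.+1)
        (p%:R - q%:R + 2%:R * i%:R) * esym x D (p + i) * esym x D (q - i).
Proof.
elim: q p => [|q IHq] p.
  rewrite big_geq // subr0 esym0 mulr1 -sum_esymD1.
  by apply: eq_bigr => j _; rewrite esym0 mulr1.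
rewrite sum_esymD1M_rec IHq [in RHS]big_nat_recl // subn1 /= addn1.
rewrite [X in _ = _ - (_ + X)](_ : _ = \sum_(1 <= i < q.+1)
   (p.+1%:R - q%:R + 2%:R * i%:R) * esym x D (p.+1 + i) * esym x D (q - i)).
  by ring.
by apply: eq_bigr => i _; rewrite subSS addSnnS -!natr1; congr (_ * _ * _); ring.
Qed.

End Esym.

(** * Derivatives *)

Section Derivatives.

Variables (R : comNzRingType) (n : nat) (I : finType) (f : I -> 'I_n).
Hypothesis f_inj : injective f.

Let x (j : I) : {mpoly R[n]} := 'X_(f j).

Lemma mderiv_prod_eq0 (i : 'I_n) (A : {set I}) (y : I -> {mpoly R[n]}) :
  (forall j, j \in A -> (y j)^`M(i) = 0) -> (\prod_(j in A) y j)^`M(i) = 0.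
Proof.
move=> y0; apply: (big_ind (fun p : {mpoly R[n]} => p^`M(i) = 0)) => //.
  by rewrite -mpolyC1 mderivC.
by move=> p q p0 q0; rewrite mderivM p0 q0 mul0r mulr0 addr0.
Qed.

Lemma mderiv_esym_eq0 (i : 'I_n) (D : {set I}) k :
  (forall j, j \in D -> f j != i) -> (esym x D k)^`M(i) = 0.
Proof.
move=> Di; rewrite /esym raddf_sum big1 // => A /andP[/subsetP AD _] /=.
apply: mderiv_prod_eq0 => j /AD /Di /negPf ji.
by rewrite mderivX mnm1E ji scale0r.
Qed.

Lemma mderiv_esymD1 j (D : {set I}) k : (esym x (D :\ j) k)^`M(f j) = 0.
Proof. by apply: mderiv_esym_eq0 => l; rewrite !inE (inj_eq f_inj) => /andP[]. Qed.

Lemma mderiv_esym j (D : {set I}) k : j \in D ->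
  (esym x D k.+1)^`M(f j) = esym x (D :\ j) k.
Proof.
move=> jD; rewrite (esym_pascal _ _ jD) mderivD mderivM !mderiv_esymD1.
rewrite mderivX mnm1E eqxx mulr0 addr0 add0r -[X in (X - _)%MM]add0m addmK.
by rewrite mpolyX0 scale1r mul1r.
Qed.

(** Only the cross terms survive, because [e_k] is affine in [x_j]. *)
Lemma mderiv2_esymM j (D : {set I}) p q : j \in D ->
  (esym x D p.+1 * esym x D q.+1)^`M(f j)^`M(f j) =
    2%:R * (esym x (D :\ j) p * esym x (D :\ j) q).
Proof.
move=> jD; rewrite mderivM !mderiv_esym // mderivD !mderivM.
by rewrite !mderiv_esym // !mderiv_esymD1; ring.
Qed.

End Derivatives.

(** * The Laplacian *)

Lemma shift_ordE (m : nat) (j : 'I_m) : @shift_ord m.+1 j = lift ord0 j.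
Proof. exact: val_inj. Qed.

Lemma etailE (n : nat) (R : comNzRingType) k :
  etail n R k = esym (fun j => 'X_(shift_ord j) : {mpoly R[n]}) [set: 'I_n.-1] k.
Proof.
rewrite /etail /mesym /esym raddf_sum /=; apply: eq_big => [A|A _].
  by rewrite subsetT.
by rewrite rmorph_prod; apply: eq_bigr => j _ /=;
  rewrite comp_mpolyXU -tnth_nth tnth_mktuple.
Qed.

Theorem lemma5p1 (R : comNzRingType) (n : nat) (hn : (2 <= n)%N)
    (k h : nat) (h_ge1 : (1 <= h)%N) (hk : (h <= k)%N) :
  laplacian (etail n R k * etail n R h) =
    2%:R * (n%:R - k%:R) * etail n R (k - 1) * etail n R (h - 1)
    - 2%:R * \sum_(1 <= i < h)
        (k%:R - h%:R + 2%:R * i%:R)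
          * etail n R (k + i - 1) * etail n R (h - i - 1).
Proof.
case: n hn => [//|m] _.
case: h h_ge1 hk => [//|q] _; case: k => [//|p] _.
have shift_inj : injective (@shift_ord m.+1).
  by move=> i j; rewrite !shift_ordE; apply: lift_inj.
rewrite /laplacian big_ord_recl.
(* The variable of index [0] occurs in neither factor. *)
rewrite mderivM !etailE !mderiv_esym_eq0; first last.
- by move=> j _; rewrite shift_ordE eq_sym neq_lift.
- by move=> j _; rewrite shift_ordE eq_sym neq_lift.
rewrite mul0r mulr0 addr0 mderiv0 add0r.
under eq_bigr => j _ do rewrite -shift_ordE mderiv2_esymM ?inE //.
rewrite -mulr_sumr.
have -> : forall F : 'I_m -> {mpoly R[m.+1]},
    \sum_(j < m) F j = \sum_(j in [set: 'I_m]) F j.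
  by move=> F; apply: eq_bigl => j; rewrite inE.
rewrite sum_esymD1M cardsT card_ord !subn1 /= mulrBr.
congr (_ - _); first by rewrite -!natr1; ring.
congr (_ * _); apply: eq_bigr => i _.
rewrite !etailE addSn subn1 /= subnAC subn1 /=.
by congr (_ * _ * _); rewrite -!natr1; ring.
Qed.
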